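(* Let $\delta\in\{1,\tfrac12\}$, and let $s$ and $z$ be complex numbers with $\operatorname{Re} s>1$ and $|z|<1$. Then $$\chi_s(z)=\frac1\delta\int_0^\delta S(s,\pi t)\,\frac{2z(1+z^2)\sin(\pi t)}{1-2z^2\cos(2\pi t)+z^4}\,dt$$ and $$\chi_s(z)=\frac1\delta\int_0^\delta C(s,\pi t)\,\frac{2z(1-z^2)\cos(\pi t)}{1-2z^2\cos(2\pi t)+z^4}\,dt.$$
   Context: The Legendre chi function is $\chi_s(z)=\sum_{k=0}^\infty \frac{z^{2k+1}}{(2k+1)^s}$ for complex $z,s$ with $|z|\le 1$ and $\operatorname{Re}s>1$. For $\operatorname{Re}s>1$ and real $x$, define $$S(s,x)=\sum_{k=0}^\infty\frac{\sin((2k+1)x)}{(2k+1)^s},\qquad C(s,x)=\sum_{k=0}^\infty\frac{\cos((2k+1)x)}{(2k+1)^s}.$$ *)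

(* Defs.v *)
From Stdlib Require Import Reals.
From Coquelicot Require Import Coquelicot.

Open Scope R_scope.

Definition Cexp (w : C) : C :=
  (exp (Re w) * (cos (Im w) + Ci * sin (Im w)))%C.

(* Principal power x ^ s = exp (s ln x); meaningful only for real x > 0. *)
Definition Rcpow (x : R) (s : C) : C := Cexp (s * ln x)%C.

(* [Series] is real-valued, so a complex series is summed componentwise;
   the value is meaningful only for convergent series, see
   [CSeries_unique]. *)
Definition CSeries (a : nat -> C) : C :=
  (Series (fun k => Re (a k)), Series (fun k => Im (a k))).

Lemma CSeries_unique (a : nat -> C) (l : C) :
  is_series (V := C_R_NormedModule) a l -> CSeries a = l.
Proof.
  intros H; destruct l as [lr li]; unfold CSeries.
  assert (Hs : forall n, @sum_n C_R_NormedModule a n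
    = (sum_n (fun k => Re (a k)) n, sum_n (fun k => Im (a k)) n)).
  { induction n as [|n IH].
    - rewrite !sum_O; now destruct (a 0%nat).
    - rewrite !sum_Sn, IH; now destruct (a (S n)). }
  f_equal; apply is_series_unique; intros P [eps HP].
  - assert (HQ : locally (T := C_R_NormedModule) (lr, li) (fun y => P (Re y))).
    { exists eps; intros y [Hy _]; apply HP; exact Hy. }
    destruct (H _ HQ) as [N HN]; exists N; intros n Hn.
    specialize (HN n Hn); now rewrite Hs in HN.
  - assert (HQ : locally (T := C_R_NormedModule) (lr, li) (fun y => P (Im y))).
    { exists eps; intros y [_ Hy]; apply HP; exact Hy. }
    destruct (H _ HQ) as [N HN]; exists N; intros n Hn.
    specialize (HN n Hn); now rewrite Hs in HN.
Qed.

Definition legendre_chi (s z : C) : C :=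
  CSeries (fun k => z ^ (2 * k + 1) / Rcpow (INR (2 * k + 1)) s)%C.

Definition sin_sum (s : C) (x : R) : C :=
  CSeries (fun k =>
    RtoC (sin (INR (2 * k + 1) * x)) / Rcpow (INR (2 * k + 1)) s)%C.

Definition cos_sum (s : C) (x : R) : C :=
  CSeries (fun k =>
    RtoC (cos (INR (2 * k + 1) * x)) / Rcpow (INR (2 * k + 1)) s)%C.

Definition sin_kernel (z : C) (t : R) : C :=
  (2 * z * (1 + z ^ 2) * RtoC (sin (PI * t))
     / (1 - 2 * z ^ 2 * RtoC (cos (2 * PI * t)) + z ^ 4))%C.

Definition cos_kernel (z : C) (t : R) : C :=
  (2 * z * (1 - z ^ 2) * RtoC (cos (PI * t))
     / (1 - 2 * z ^ 2 * RtoC (cos (2 * PI * t)) + z ^ 4))%C.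

(* Main.v *)
Require Import Defs.
From Stdlib Require Import Reals Lra Lia.
From Coquelicot Require Import Coquelicot.
Open Scope R_scope.

(** The formulas are instances of Parseval's identity. Write [e_n] for the odd
    sines [sin ((2 n + 1) PI t)], or for the odd cosines. On [[0, 1]], and
    already on [[0, 1/2]], they are orthogonal, with integral of the square
    [delta / 2] ([sin_cos_odd_orthogonal]).

    The function [sin_sum s (PI t)] has coefficients [1 / (2 n + 1) ^ s] along
    [e_n], and these are absolutely summable because [Re s > 1]. The kernel has
    coefficients [2 z ^ (2 n + 1)], absolutely summable because [Cmod z < 1]:
    since [e_(n+2) + e_n = 2 cos (2 PI t) e_(n+1)], multiplying the series of
    [z ^ (2 n + 1) e_n] by [1 - 2 z ^ 2 cos (2 PI t) + z ^ 4] leaves only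
    contributions of the first two terms ([is_series_odd_generating]). This
    denominator does not vanish for [Cmod z < 1]
    ([kernel_denominator_neq_0]).

    Termwise integration of the uniformly convergent series
    ([is_RInt_series]), used twice, gives the integral of the product as
    [delta / 2] times the sum of [2 z ^ (2 n + 1) / (2 n + 1) ^ s]
    ([is_RInt_orthogonal_series]), which is [delta] times [legendre_chi s z]. *)

(** * Series and integrals of complex functions *)

(** The norm of the product module [R * R] underlying [C_R_NormedModule] is the
    complex modulus. *)
Lemma norm_C_R (x : C) : norm (V := C_R_NormedModule) x = Cmod x.
Proof.
  unfold norm; simpl; unfold prod_norm, Cmod.
  unfold norm; simpl; unfold abs; simpl.
  f_equal; rewrite !Rmult_1_r, <- !Rabs_mult.
  f_equal; apply Rabs_pos_eq, Rle_0_sqr.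
Qed.

Lemma norm_series_le {V : NormedModule R_AbsRing} (a : nat -> V) (l : V)
    (m : nat -> R) :
  (forall n, norm (a n) <= m n) -> ex_series m -> is_series a l ->
  norm l <= Series m.
Proof.
  intros Hm Hsm Hl.
  apply (is_lim_seq_le (fun N => norm (sum_n a N)) (sum_n m) (norm l) (Series m)).
  - intros N; eapply Rle_trans; [apply norm_sum_n_m|].
    apply (sum_n_m_le _ m); intros k; apply Hm.
  - eapply filterlim_comp; [exact Hl|apply filterlim_norm].
  - apply Series_correct, Hsm.
Qed.

(** Complex scalars act on series although [C_R_NormedModule] is a module
    over [R]. *)
Lemma is_series_Cmult_l (c : C) (a : nat -> C) (l : C) :
  is_series (V := C_R_NormedModule) a l ->
  is_series (V := C_R_NormedModule) (fun n => c * a n)%C (c * l)%C.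
Proof.
  intros H. exact (is_series_scal (V := C_NormedModule) c a l H).
Qed.

Lemma is_series_Cplus (a b : nat -> C) (l k : C) :
  is_series (V := C_R_NormedModule) a l ->
  is_series (V := C_R_NormedModule) b k ->
  is_series (V := C_R_NormedModule) (fun n => a n + b n)%C (l + k)%C.
Proof.
  exact (is_series_plus (V := C_R_NormedModule) a b l k).
Qed.

Lemma is_series_tail (a : nat -> C) (l : C) :
  is_series (V := C_R_NormedModule) a l ->
  is_series (V := C_R_NormedModule) (fun n => a (S n)) (l - a 0%nat)%C.
Proof.
  intros H. apply (is_series_incr_1 (V := C_R_NormedModule)).
  assert (E : plus (G := C_R_NormedModule) (l - a 0%nat)%C (a 0%nat) = l)
    by (change (l - a 0%nat + a 0%nat = l)%C; ring).
  now rewrite E.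
Qed.

Lemma is_series_single (a : nat -> C) (k : nat) (l : C) :
  (forall n, a n = if Nat.eqb n k then l else RtoC 0) ->
  is_series (V := C_R_NormedModule) a l.
Proof.
  intros Ha.
  assert (H : forall N, sum_n (G := C_R_NormedModule) a N
                        = if Nat.leb k N then l else RtoC 0).
  { induction N as [|N IH].
    - rewrite sum_O, Ha. now destruct k.
    - rewrite sum_Sn, IH, Ha.
      destruct (Nat.leb_spec k N), (Nat.eqb_spec (S N) k), (Nat.leb_spec k (S N));
        try lia; apply injective_projections; simpl; unfold plus; simpl; ring. }
  apply (filterlim_ext_loc (fun _ => l)); [|apply filterlim_const].
  exists k; intros N HN; rewrite H.
  now destruct (Nat.leb_spec k N); [|lia].
Qed.

Lemma is_RInt_C_ext (f g : R -> C) (a b : R) (l : C) :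
  (forall t, f t = g t) ->
  is_RInt (V := C_R_NormedModule) f a b l ->
  is_RInt (V := C_R_NormedModule) g a b l.
Proof.
  intros H; apply (is_RInt_ext (V := C_R_NormedModule)); intros t _; apply H.
Qed.

(** The module structure is over [R], so linearity for complex constants is
    obtained componentwise. *)
Lemma is_RInt_Cmult_l (c : C) (f : R -> C) (a b : R) (l : C) :
  is_RInt (V := C_R_NormedModule) f a b l ->
  is_RInt (V := C_R_NormedModule) (fun t => c * f t)%C a b (c * l)%C.
Proof.
  intros H.
  pose proof (is_RInt_fct_extend_fst (U := R_NormedModule) (V := R_NormedModule)
    _ _ _ _ H) as H1.
  pose proof (is_RInt_fct_extend_snd (U := R_NormedModule) (V := R_NormedModule)
    _ _ _ _ H) as H2.
  apply (is_RInt_fct_extend_pair (U := R_NormedModule) (V := R_NormedModule)).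
  - exact (is_RInt_minus (V := R_NormedModule) _ _ _ _ _ _
      (is_RInt_scal (V := R_NormedModule) _ _ _ (fst c) _ H1)
      (is_RInt_scal (V := R_NormedModule) _ _ _ (snd c) _ H2)).
  - exact (is_RInt_plus (V := R_NormedModule) _ _ _ _ _ _
      (is_RInt_scal (V := R_NormedModule) _ _ _ (fst c) _ H2)
      (is_RInt_scal (V := R_NormedModule) _ _ _ (snd c) _ H1)).
Qed.

Lemma is_RInt_RtoC (f : R -> R) (a b l : R) :
  is_RInt f a b l ->
  is_RInt (V := C_R_NormedModule) (fun t => RtoC (f t)) a b (RtoC l).
Proof.
  intros H.
  apply (is_RInt_fct_extend_pair (U := R_NormedModule) (V := R_NormedModule)).
  - exact H.
  - pose proof (is_RInt_const (V := R_NormedModule) a b 0) as H0.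
    change (scal (b - a) 0) with ((b - a) * 0) in H0.
    now rewrite Rmult_0_r in H0.
Qed.

(** * Termwise integration and Parseval's identity *)

(** Weierstrass test and termwise integration: a series dominated by a
    convergent numerical series may be integrated term by term. The domination
    is required on the whole line. *)
Lemma is_RInt_series {V : CompleteNormedModule R_AbsRing}
    (f : nat -> R -> V) (F : R -> V) (m : nat -> R) (a b : R) (c : nat -> V) :
  (forall n t, norm (f n t) <= m n) -> ex_series m ->
  (forall t, is_series (fun n => f n t) (F t)) ->
  (forall n, is_RInt (f n) a b (c n)) ->
  exists I : V, is_series c I /\ is_RInt F a b I.
Proof.
  intros Hm Hsm HF Hc.
  refine (filterlim_RInt (fun N t => sum_n (fun n => f n t) N) a b eventually _
            F (sum_n c) _ _).
  - intros N; induction N as [|N IH].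
    + rewrite sum_O; apply (is_RInt_ext (f 0%nat)).
      * intros t _; now rewrite sum_O.
      * apply Hc.
    + rewrite sum_Sn.
      apply (is_RInt_ext (fun t => plus (sum_n (fun n => f n t) N) (f (S N) t))).
      * intros t _; now rewrite sum_Sn.
      * now apply @is_RInt_plus.
  - apply filterlim_locally; intros eps.
    destruct (Cauchy_ex_series m Hsm (pos_div_2 eps)) as [N HN].
    exists N; intros n Hn t.
    (* [N] comes from the Cauchy criterion for [m], hence does not depend on
       [t]; the later partial sum [p], which does, is only a stepping stone. *)
    destruct (proj1 (filterlim_locally _ _) (HF t) (pos_div_2 eps)) as [p0 Hp0].
    set (p := S (max n p0)).
    replace (pos eps) with (eps / 2 + eps / 2) by field.
    apply ball_triangle with (sum_n (fun k => f k t) p).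
    + apply Hp0; unfold p; lia.
    + apply ball_sym, (norm_compat1 (V := V)).
      rewrite <- (sum_n_m_sum_n (G := V) (fun k => f k t)) by (unfold p; lia).
      eapply Rle_lt_trans; [apply (norm_sum_n_m (V := V))|].
      eapply Rle_lt_trans; [apply (sum_n_m_le _ m); intros k; apply Hm|].
      eapply Rle_lt_trans; [apply Rle_abs|].
      apply HN; unfold p; lia.
Qed.

Lemma Cmod_bounded_coeff_le (c : C) (x : R) :
  Rabs x <= 1 -> Cmod (c * RtoC x) <= Cmod c.
Proof.
  intros Hx. rewrite Cmod_mult, Cmod_R.
  rewrite <- (Rmult_1_r (Cmod c)) at 2.
  apply Rmult_le_compat_l; [apply Cmod_ge_0|exact Hx].
Qed.

Lemma ex_series_bounded_coeff (a : nat -> C) (x : nat -> R) :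
  ex_series (fun n => Cmod (a n)) -> (forall n, Rabs (x n) <= 1) ->
  exists l : C, is_series (V := C_R_NormedModule) (fun n => a n * RtoC (x n))%C l.
Proof.
  intros Ha Hx.
  apply (ex_series_le (V := C_R_CompleteNormedModule) _ (fun n => Cmod (a n)));
    [|exact Ha].
  intros n; rewrite norm_C_R. now apply Cmod_bounded_coeff_le.
Qed.

(** Parseval's identity: for two absolutely convergent expansions along an
    orthogonal family [e], bounded by [1] and of square norm [d], the integral of the
    product is [d] times the sum of the products of the coefficients. *)
Lemma is_RInt_orthogonal_series (e : nat -> R -> R) (a b : nat -> C)
    (A B : R -> C) (l r d : R) :
  (forall n t, Rabs (e n t) <= 1) ->
  (forall j k, is_RInt (fun t => e j t * e k t) l r
                 (if Nat.eqb j k then d else 0)) ->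
  ex_series (fun n => Cmod (a n)) -> ex_series (fun n => Cmod (b n)) ->
  (forall t, is_series (V := C_R_NormedModule)
               (fun n => a n * RtoC (e n t))%C (A t)) ->
  (forall t, is_series (V := C_R_NormedModule)
               (fun n => b n * RtoC (e n t))%C (B t)) ->
  exists I : C,
    is_series (V := C_R_NormedModule) (fun n => d * (a n * b n))%C I /\
    is_RInt (V := C_R_NormedModule) (fun t => A t * B t)%C l r I.
Proof.
  intros He Ho Ha Hb HA HB.
  assert (Hle : forall (c : nat -> C) n t, Cmod (c n * RtoC (e n t)) <= Cmod (c n)).
  { intros c n t. apply Cmod_bounded_coeff_le, He. }
  assert (HAb : forall t, Cmod (A t) <= Series (fun n => Cmod (a n))).
  { intros t. rewrite <- norm_C_R.
    apply (norm_series_le (V := C_R_NormedModule) (fun n => a n * RtoC (e n t))%C);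
      [|exact Ha|apply HA].
    intros n; rewrite norm_C_R; apply Hle. }
  (* Expanding only [A] gives the coefficients of [A] against each [e k];
     expanding [B] against the fixed bounded function [A] then concludes. *)
  assert (Hk : forall k, is_RInt (V := C_R_NormedModule)
     (fun t => A t * RtoC (e k t))%C l r (d * a k)%C).
  { intros k.
    destruct (is_RInt_series (V := C_R_CompleteNormedModule)
      (fun n t => RtoC (e k t) * (a n * RtoC (e n t)))%C
      (fun t => RtoC (e k t) * A t)%C (fun n => Cmod (a n)) l r
      (fun n => if Nat.eqb n k then d * a k else RtoC 0)%C) as [I [HI1 HI2]].
    - intros n t. rewrite norm_C_R.
      rewrite Cmult_comm.
      rewrite <- (Rmult_1_r (Cmod (a n))), Cmod_mult, Cmod_R.
      apply Rmult_le_compat; [apply Cmod_ge_0|apply Rabs_pos|apply Hle|apply He].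
    - exact Ha.
    - intros t. now apply is_series_Cmult_l.
    - intros n.
      pose proof (is_RInt_Cmult_l (a n) _ _ _ _ (is_RInt_RtoC _ _ _ _ (Ho n k))) as H.
      apply (is_RInt_C_ext
        (fun t => a n * RtoC (e n t * e k t))%C).
      { intros t. rewrite RtoC_mult. ring. }
      destruct (Nat.eqb_spec n k) as [E|_]; [subst k|].
      + rewrite Cmult_comm; exact H.
      + now rewrite Cmult_0_r in H.
    - assert (I = (d * a k)%C) as <-.
      { apply (filterlim_locally_unique (V := C_R_NormedModule) (F := eventually) _ _ _ HI1).
        now apply is_series_single with k. }
      apply (is_RInt_C_ext (fun t => RtoC (e k t) * A t)%C); [|exact HI2].
      intros t; apply Cmult_comm. }
  destruct (is_RInt_series (V := C_R_CompleteNormedModule)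
    (fun n t => A t * (b n * RtoC (e n t)))%C (fun t => A t * B t)%C
    (fun n => Series (fun n => Cmod (a n)) * Cmod (b n)) l r
    (fun n => d * (a n * b n))%C) as [I HI].
  - intros n t. rewrite norm_C_R.
    rewrite Cmod_mult.
    apply Rmult_le_compat; [apply Cmod_ge_0|apply Cmod_ge_0|apply HAb|apply Hle].
  - now apply (ex_series_scal (V := R_NormedModule)).
  - intros t. now apply is_series_Cmult_l.
  - intros n. pose proof (is_RInt_Cmult_l (b n) _ _ _ _ (Hk n)) as H.
    replace (d * (a n * b n))%C with (b n * (d * a n))%C by ring.
    apply (is_RInt_C_ext
        (fun t => b n * (A t * RtoC (e n t)))%C); [|exact H].
    intros t. ring.
  - now exists I.
Qed.

(** * Absolute convergence of the coefficient series *)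

(** Convergence of the series of [1 / n ^ s] for real [s > 1]. *)
Lemma ex_series_Rpower (s : R) :
  1 < s -> ex_series (fun n => Rpower (INR (S n)) (- s)).
Proof.
  intros hs.
  set (v := fun n => Rpower (INR (S n)) (- s)).
  set (u := fun n => Rpower (INR (S n)) (1 - s)).
  (* Comparison of [v] with the telescoping differences of [u]. *)
  assert (Hstep : forall n, (s - 1) * v (S n) <= u n - u (S n)).
  { intros n. unfold u, v.
    assert (Hx : 0 < INR (S n)) by (apply lt_0_INR; lia).
    rewrite (S_INR (S n)).
    set (x := INR (S n)) in *. set (y := x + 1).
    assert (Hy : 0 < y) by (unfold y; lra).
    (* [ln (x / y) <= x / y - 1], and [x / y - 1 = - / y]. *)
    assert (Hln : / y <= ln y - ln x).
    { pose proof (exp_ineq1_le (ln (x / y))) as H.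
      rewrite exp_ln in H by now apply Rdiv_lt_0_compat.
      rewrite ln_div in H by assumption.
      replace (x / y) with (1 - / y) in H by (unfold y; field; lra). lra. }
    assert (Hux : Rpower x (1 - s) = Rpower y (1 - s) * exp ((s - 1) * (ln y - ln x))).
    { unfold Rpower. rewrite <- exp_plus. f_equal; ring. }
    assert (Hvy : Rpower y (- s) = Rpower y (1 - s) * / y).
    { replace (- s) with ((1 - s) + - (1)) by ring.
      now rewrite Rpower_plus, Rpower_Ropp, Rpower_1. }
    rewrite Hux, Hvy.
    pose proof (exp_ineq1_le ((s - 1) * (ln y - ln x))) as He.
    assert (Hp : 0 < Rpower y (1 - s)) by apply exp_pos.
    assert ((s - 1) * / y <= exp ((s - 1) * (ln y - ln x)) - 1).
    { apply Rle_trans with ((s - 1) * (ln y - ln x)); [|lra].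
      apply Rmult_le_compat_l; lra. }
    nra. }
  assert (Hv : forall n, 0 < v n) by (intros n; apply exp_pos).
  apply ex_series_incr_1.
  apply (ex_finite_lim_seq_incr _ (/ (s - 1))).
  - intros n. rewrite sum_Sn. unfold plus; simpl. specialize (Hv (S (S n))). lra.
  - intros n.
    assert (H : (s - 1) * sum_n (fun k => v (S k)) n <= u 0%nat - u (S n)).
    { induction n as [|n IH].
      - rewrite sum_O. apply Hstep.
      - rewrite sum_Sn. specialize (Hstep (S n)).
        match goal with |- context [plus ?x ?y] => change (plus x y) with (x + y) end.
        lra. }
    assert (H0 : u 0%nat = 1).
    { unfold u, Rpower; simpl. now rewrite ln_1, Rmult_0_r, exp_0. }
    assert (Hu : 0 < u (S n)) by apply exp_pos.
    apply Rmult_le_reg_l with (s - 1); [lra|].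
    rewrite Rinv_r by lra. eapply Rle_trans; [exact H|lra].
Qed.

Lemma Cmod_cos_sin (y : R) : Cmod (cos y, sin y) = 1.
Proof.
  unfold Cmod; simpl.
  pose proof (sin2_cos2 y) as H; unfold Rsqr in H.
  transitivity (sqrt 1); [f_equal; lra|apply sqrt_1].
Qed.

Lemma Cmod_Rcpow (x : R) (s : C) : Cmod (Rcpow x s) = Rpower x (Re s).
Proof.
  unfold Rcpow, Cexp, Rpower.
  rewrite Cmod_mult, Cmod_R, Rabs_pos_eq by apply Rlt_le, exp_pos.
  replace (Re (s * ln x)) with (Re s * ln x) by (unfold Re; simpl; ring).
  rewrite <- (Rmult_1_r (exp (Re s * ln x))) at 2. f_equal.
  set (y := Im _).
  replace (cos y + Ci * sin y)%C with (cos y, sin y)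
    by (apply injective_projections; simpl; ring).
  apply Cmod_cos_sin.
Qed.

Lemma ex_series_Cmod_inv_Rcpow_odd (s : C) :
  1 < Re s -> ex_series (fun n => Cmod (/ Rcpow (INR (2 * n + 1)) s)).
Proof.
  intros hs.
  apply (ex_series_le (V := R_CompleteNormedModule) _
           (fun n => Rpower (INR (S n)) (- Re s))); [|now apply ex_series_Rpower].
  intros n. change (Rabs (Cmod (/ Rcpow (INR (2 * n + 1)) s))
                    <= Rpower (INR (S n)) (- Re s)).
  rewrite Rabs_pos_eq by apply Cmod_ge_0.
  assert (H1 : 0 < INR (S n)) by (apply lt_0_INR; lia).
  rewrite Cmod_inv.
  - rewrite Cmod_Rcpow, Rpower_Ropp.
    apply Rinv_le_contravar; [apply exp_pos|].
    apply Rle_Rpower_l; [lra|]. split; [assumption|]. apply le_INR; lia.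
  - apply Cmod_gt_0. rewrite Cmod_Rcpow. apply exp_pos.
Qed.

Lemma ex_series_Cmod_odd_powers (z : C) :
  Cmod z < 1 -> ex_series (fun n => Cmod (2 * z ^ (2 * n + 1))).
Proof.
  intros hz. pose proof (Cmod_ge_0 z) as h0.
  apply (ex_series_le (V := R_CompleteNormedModule) _ (fun n => 2 * Cmod z ^ n)).
  - intros n. change (Rabs (Cmod (2 * z ^ (2 * n + 1))) <= 2 * Cmod z ^ n).
    rewrite Rabs_pos_eq by apply Cmod_ge_0.
    rewrite Cmod_mult, Cmod_R, Cmod_pow, Rabs_pos_eq by lra.
    apply Rmult_le_compat_l; [lra|].
    replace (2 * n + 1)%nat with (n + (n + 1))%nat by lia.
    rewrite pow_add. rewrite <- (Rmult_1_r (Cmod z ^ n)) at 2.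
    apply Rmult_le_compat_l; [now apply pow_le|].
    rewrite <- (pow1 (n + 1)). apply pow_incr. lra.
  - apply (ex_series_scal (V := R_NormedModule) 2), ex_series_geom.
    rewrite Rabs_pos_eq; lra.
Qed.

(** * Expansion of the kernels *)

Lemma kernel_denominator_neq_0 (w : C) (y : R) :
  Cmod w < 1 -> (1 - 2 * w * RtoC (cos y) + w ^ 2)%C <> 0.
Proof.
  intros hw.
  assert (Hf : forall y, (1 - w * (cos y, sin y))%C <> 0).
  { intros y0 H.
    assert (H1 : Cmod (w * (cos y0, sin y0))%C = 1).
    { replace (w * (cos y0, sin y0))%C with (1 - (1 - w * (cos y0, sin y0)))%C by ring.
      rewrite H. replace (1 - 0)%C with (RtoC 1) by ring. apply Cmod_1. }
    rewrite Cmod_mult, Cmod_cos_sin in H1. lra. }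
  (* The denominator is [(1 - w e^(iy)) (1 - w e^(-iy))]. *)
  replace (1 - 2 * w * RtoC (cos y) + w ^ 2)%C
    with ((1 - w * (cos y, sin y)) * (1 - w * (cos (- y), sin (- y))))%C.
  - apply Cmult_neq_0; apply Hf.
  - rewrite cos_neg, sin_neg.
    replace (cos y, sin y) with (cos y + Ci * sin y)%C
      by (apply injective_projections; simpl; ring).
    replace (cos y, - sin y) with (cos y - Ci * sin y)%C
      by (apply injective_projections; simpl; ring).
    assert (E : (Ci * Ci = -1)%C) by (apply injective_projections; simpl; ring).
    assert (E2 : (RtoC (sin y) * RtoC (sin y) + RtoC (cos y) * RtoC (cos y) = 1)%C).
    { pose proof (sin2_cos2 y) as Hs; unfold Rsqr in Hs.
      rewrite <- !RtoC_mult, <- RtoC_plus. now rewrite Hs. }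
    transitivity (1 - 2 * w * cos y
      + w ^ 2 * (cos y * cos y - (Ci * Ci) * (sin y * sin y)))%C; [ring|].
    rewrite E. replace (RtoC (-1)) with (- RtoC 1)%C by (rewrite <- RtoC_opp; reflexivity).
    transitivity (1 - 2 * w * cos y
      + w ^ 2 * (sin y * sin y + cos y * cos y))%C; [ring|].
    rewrite E2. ring.
Qed.

(** If the terms satisfy a second-order linear recurrence, the sum times the
    characteristic polynomial at [1] depends only on the first two terms. *)
Lemma is_series_three_term_recurrence (T : nat -> C) (p q I : C) :
  (forall n, T (S (S n)) - p * T (S n) + q * T n = 0)%C ->
  is_series (V := C_R_NormedModule) T I ->
  ((1 - p + q) * I = T 0%nat + T 1%nat - p * T 0%nat)%C.
Proof.
  intros Hr HI.
  pose proof (is_series_tail _ _ HI) as H1.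
  pose proof (is_series_tail _ _ H1) as H2; cbv beta in H2.
  pose proof (is_series_Cplus _ _ _ _
    (is_series_Cplus _ _ _ _ H2 (is_series_Cmult_l (- p) _ _ H1))
    (is_series_Cmult_l q _ _ HI)) as H; cbv beta in H.
  (* Summing the recurrence termwise: its left side sums to [0]. *)
  assert (E : (I - T 0%nat - T 1%nat + - p * (I - T 0%nat) + q * I = 0)%C).
  { apply (filterlim_locally_unique (V := C_R_NormedModule) (F := eventually) _ _ _ H).
    apply is_series_single with 0%nat. intros n.
    transitivity (T (S (S n)) - p * T (S n) + q * T n)%C; [ring|].
    rewrite (Hr n). now destruct n. }
  replace ((1 - p + q) * I)%C with
    ((I - T 0%nat - T 1%nat + - p * (I - T 0%nat) + q * I)
      + (T 0%nat + T 1%nat - p * T 0%nat))%C by ring.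
  rewrite E. ring.
Qed.

(** Generating function of a sequence bounded by [1] and satisfying the recurrence of
    [sin ((2 n + 1) x)] and [cos ((2 n + 1) x)], with [y] in the role of [2 x]. *)
Lemma is_series_odd_generating (x : nat -> R) (y : R) (z : C) :
  Cmod z < 1 -> (forall n, Rabs (x n) <= 1) ->
  (forall n, x (S (S n)) + x n = 2 * cos y * x (S n)) ->
  is_series (V := C_R_NormedModule)
    (fun n => 2 * z ^ (2 * n + 1) * RtoC (x n))%C
    (2 * (z * x 0%nat + z ^ 3 * (x 1%nat - 2 * RtoC (cos y) * x 0%nat))
       / (1 - 2 * z ^ 2 * RtoC (cos y) + z ^ 4))%C.
Proof.
  intros hz Hx Hr.
  destruct (ex_series_bounded_coeff _ x (ex_series_Cmod_odd_powers z hz) Hx)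
    as [I HI].
  assert (HD : (1 - 2 * z ^ 2 * RtoC (cos y) + z ^ 4)%C <> 0).
  { replace (z ^ 4)%C with ((z ^ 2) ^ 2)%C by ring.
    apply kernel_denominator_neq_0.
    rewrite Cmod_pow. pose proof (Cmod_ge_0 z). simpl. nra. }
  assert (E := is_series_three_term_recurrence
    (fun n => 2 * z ^ (2 * n + 1) * RtoC (x n))%C
    (2 * z ^ 2 * RtoC (cos y))%C (z ^ 4)%C I).
  match goal with |- is_series _ ?l => replace l with I; [exact HI|] end.
  (* The sum [I] times the denominator is given by the recurrence. *)
  transitivity ((1 - 2 * z ^ 2 * RtoC (cos y) + z ^ 4) * I
                  / (1 - 2 * z ^ 2 * RtoC (cos y) + z ^ 4))%C;
    [field; exact HD|].
  rewrite E; [|intros n|exact HI].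
  - simpl (2 * 0 + 1)%nat. simpl (2 * 1 + 1)%nat. field. exact HD.
  - replace (2 * S (S n) + 1)%nat with (2 * n + 1 + 4)%nat by lia.
    replace (2 * S n + 1)%nat with (2 * n + 1 + 2)%nat by lia.
    rewrite !Cpow_add_r.
    replace (x (S (S n))) with (2 * cos y * x (S n) - x n) by (rewrite <- Hr; ring).
    rewrite RtoC_minus, !RtoC_mult. ring.
Qed.

Lemma odd_multiples_recurrence (x : R) (n : nat) :
  INR (2 * S (S n) + 1) * x = INR (2 * S n + 1) * x + 2 * x /\
  INR (2 * n + 1) * x = INR (2 * S n + 1) * x - 2 * x.
Proof.
  rewrite !plus_INR, !mult_INR, !S_INR. simpl. split; ring.
Qed.

Lemma is_series_sin_kernel (z : C) (t : R) :
  Cmod z < 1 ->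
  is_series (V := C_R_NormedModule)
    (fun n => 2 * z ^ (2 * n + 1) * RtoC (sin (INR (2 * n + 1) * (PI * t))))%C
    (sin_kernel z t).
Proof.
  intros hz.
  pose proof (is_series_odd_generating (fun n => sin (INR (2 * n + 1) * (PI * t)))
    (2 * (PI * t)) z hz) as H.
  unfold sin_kernel. replace (2 * PI * t) with (2 * (PI * t)) by ring.
  set (x := PI * t) in *.
  match goal with |- is_series _ ?l => match type of H with _ -> _ -> is_series _ ?l' =>
    replace l with l' end end; [apply H|].
  - intros n; apply Rabs_le, SIN_bound.
  - intros n. destruct (odd_multiples_recurrence x n) as [-> ->].
    rewrite sin_plus, sin_minus. ring.
  - unfold Cdiv; f_equal. cbv beta.
    replace (INR (2 * 0 + 1) * x) with x by (simpl; ring).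
    replace (INR (2 * 1 + 1) * x) with (2 * x + x) by (simpl; ring).
    (* [sin 3x - 2 cos 2x sin x = sin x], the source of the factor [1 + z^2]. *)
    assert (E : sin (2 * x + x) = sin x + 2 * cos (2 * x) * sin x).
    { rewrite <- (Rplus_0_l (sin x)) at 1.
      rewrite sin_plus.
      replace (sin x) with (sin (2 * x - x)) at 2 by (f_equal; ring).
      rewrite sin_minus. ring. }
    rewrite E, RtoC_plus, !RtoC_mult. ring.
Qed.

Lemma is_series_cos_kernel (z : C) (t : R) :
  Cmod z < 1 ->
  is_series (V := C_R_NormedModule)
    (fun n => 2 * z ^ (2 * n + 1) * RtoC (cos (INR (2 * n + 1) * (PI * t))))%C
    (cos_kernel z t).
Proof.
  intros hz.
  pose proof (is_series_odd_generating (fun n => cos (INR (2 * n + 1) * (PI * t)))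
    (2 * (PI * t)) z hz) as H.
  unfold cos_kernel. replace (2 * PI * t) with (2 * (PI * t)) by ring.
  set (x := PI * t) in *.
  match goal with |- is_series _ ?l => match type of H with _ -> _ -> is_series _ ?l' =>
    replace l with l' end end; [apply H|].
  - intros n; apply Rabs_le, COS_bound.
  - intros n. destruct (odd_multiples_recurrence x n) as [-> ->].
    rewrite cos_plus, cos_minus. ring.
  - unfold Cdiv; f_equal. cbv beta.
    replace (INR (2 * 0 + 1) * x) with x by (simpl; ring).
    replace (INR (2 * 1 + 1) * x) with (2 * x + x) by (simpl; ring).
    (* [cos 3x - 2 cos 2x cos x = - cos x], the source of the factor
       [1 - z^2]. *)
    assert (E : cos (2 * x + x) = 2 * cos (2 * x) * cos x - cos x).
    { rewrite cos_plus.
      replace (cos x) with (cos (2 * x - x)) at 3 by (f_equal; ring).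
      rewrite cos_minus. ring. }
    rewrite E, RtoC_minus, !RtoC_mult. ring.
Qed.

(** * Orthogonality *)

(** Both values of [delta] work because the angular frequency is an even
    multiple of [PI]: the primitive [sin (2 m PI t)] vanishes at [1 / 2] as well as at [1]. *)
Lemma is_RInt_cos_even_frequency (delta : R) (m : Z) :
  delta = 1 \/ delta = 1 / 2 ->
  is_RInt (fun t => cos (2 * IZR m * (PI * t))) 0 delta
    (if Z.eqb m 0 then delta else 0).
Proof.
  intros hd. destruct (Z.eqb_spec m 0) as [->|hm].
  - apply (is_RInt_ext (fun _ => 1)).
    { intros t _. replace (2 * 0 * (PI * t)) with 0 by ring. now rewrite cos_0. }
    replace delta with (scal (delta - 0) 1) at 2
      by (unfold scal; simpl; unfold mult; simpl; ring).
    apply (is_RInt_const (V := R_NormedModule)).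
  - pose proof PI_RGT_0 as hpi. pose proof (not_0_IZR m hm) as hm'.
    set (c := 2 * IZR m * PI).
    assert (hc : c <> 0) by (unfold c; intros E; apply Rmult_integral in E as [E|E]; lra).
    assert (Hs : sin (c * delta) = 0).
    { apply sin_eq_0_1. destruct hd as [->| ->].
      - exists (2 * m)%Z. rewrite mult_IZR. unfold c; ring.
      - exists m. unfold c; field. }
    replace 0 with (minus (sin (c * delta) / c) (sin (c * 0) / c)) at 2.
    + apply (is_RInt_derive (V := R_CompleteNormedModule) (fun t => sin (c * t) / c)).
      * intros x _. auto_derive; [easy|].
        replace (2 * IZR m * (PI * x)) with (c * x) by (unfold c; ring). field. exact hc.
      * intros x _. apply (ex_derive_continuous (V := R_NormedModule)). now auto_derive.
    + rewrite Hs, Rmult_0_r, sin_0. unfold minus, plus, opp; simpl. field. exact hc.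
Qed.

(** Orthogonality of the odd sines, and of the odd cosines, on [[0, delta]]. *)
Lemma sin_cos_odd_orthogonal (delta : R) (j k : nat) :
  delta = 1 \/ delta = 1 / 2 ->
  is_RInt (fun t => sin (INR (2 * j + 1) * (PI * t)) * sin (INR (2 * k + 1) * (PI * t)))
    0 delta (if Nat.eqb j k then delta / 2 else 0) /\
  is_RInt (fun t => cos (INR (2 * j + 1) * (PI * t)) * cos (INR (2 * k + 1) * (PI * t)))
    0 delta (if Nat.eqb j k then delta / 2 else 0).
Proof.
  intros hd.
  pose proof (is_RInt_cos_even_frequency delta (Z.of_nat j - Z.of_nat k) hd) as Hm.
  pose proof (is_RInt_cos_even_frequency delta (Z.of_nat j + Z.of_nat k + 1) hd) as Hp.
  destruct (Z.eqb_spec (Z.of_nat j + Z.of_nat k + 1) 0) as [E|_]; [lia|].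
  assert (Hang : forall t,
    2 * IZR (Z.of_nat j - Z.of_nat k) * (PI * t)
      = INR (2 * j + 1) * (PI * t) - INR (2 * k + 1) * (PI * t) /\
    2 * IZR (Z.of_nat j + Z.of_nat k + 1) * (PI * t)
      = INR (2 * j + 1) * (PI * t) + INR (2 * k + 1) * (PI * t)).
  { intros t. rewrite minus_IZR, !plus_IZR, <- !INR_IZR_INZ, !plus_INR, !mult_INR.
    simpl (INR 1); simpl (INR 2). split; ring. }
  (* Product-to-sum formulas: the frequency sum [j + k + 1] never vanishes and
     contributes [0]; the difference [j - k] contributes [v]. *)
  assert (key : forall v : R,
    is_RInt (fun t => cos (2 * IZR (Z.of_nat j - Z.of_nat k) * (PI * t))) 0 delta v ->
    is_RInt (fun t => sin (INR (2 * j + 1) * (PI * t)) * sin (INR (2 * k + 1) * (PI * t)))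
      0 delta (v / 2) /\
    is_RInt (fun t => cos (INR (2 * j + 1) * (PI * t)) * cos (INR (2 * k + 1) * (PI * t)))
      0 delta (v / 2)).
  { intros v Hv. split.
    - replace (v / 2) with (scal (/ 2) (minus v 0))
        by (unfold scal, minus, plus, opp; simpl; unfold mult; simpl; field).
      refine (is_RInt_ext _ _ _ _ _ _ (is_RInt_scal _ _ _ (/ 2) _
                (is_RInt_minus (V := R_NormedModule) _ _ _ _ _ _ Hv Hp))).
      intros t _. destruct (Hang t) as [E1 E2]. rewrite E1, E2, cos_minus, cos_plus.
      unfold scal, minus, plus, opp; simpl; unfold mult; simpl. field.
    - replace (v / 2) with (scal (/ 2) (plus v 0))
        by (unfold scal, plus; simpl; unfold mult; simpl; field).
      refine (is_RInt_ext _ _ _ _ _ _ (is_RInt_scal _ _ _ (/ 2) _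
                (is_RInt_plus (V := R_NormedModule) _ _ _ _ _ _ Hv Hp))).
      intros t _. destruct (Hang t) as [E1 E2]. rewrite E1, E2, cos_minus, cos_plus.
      unfold scal, plus; simpl; unfold mult; simpl. field. }
  destruct (Nat.eqb_spec j k) as [E|hjk].
  - apply key. subst k. rewrite Z.sub_diag in Hm |- *. exact Hm.
  - assert (E0 : 0 = 0 / 2) by field. rewrite E0 at 2 4. apply key.
    destruct (Z.eqb_spec (Z.of_nat j - Z.of_nat k) 0) as [E|_]; [lia|exact Hm].
Qed.

(** * Integral formulas for the Legendre chi function *)

(** The common form of both integral formulas: [e] is the orthogonal family,
    [K] the kernel, with coefficients [2 z ^ (2 n + 1)] along [e]. *)
Lemma legendre_chi_RInt (e : nat -> R -> R) (K : R -> C) (delta : R) (s z : C) :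
  delta <> 0 -> 1 < Re s -> Cmod z < 1 ->
  (forall n t, Rabs (e n t) <= 1) ->
  (forall j k, is_RInt (fun t => e j t * e k t) 0 delta
                 (if Nat.eqb j k then delta / 2 else 0)) ->
  (forall t, is_series (V := C_R_NormedModule)
               (fun n => 2 * z ^ (2 * n + 1) * RtoC (e n t))%C (K t)) ->
  let A t := CSeries (fun k => RtoC (e k t) / Rcpow (INR (2 * k + 1)) s)%C in
  ex_RInt (V := C_R_NormedModule) (fun t => (A t * K t)%C) 0 delta /\
  legendre_chi s z =
    (1 / RtoC delta *
     RInt (V := C_R_CompleteNormedModule) (fun t => (A t * K t)%C) 0 delta)%C.
Proof.
  intros hd hs hz He Ho HK A.
  pose proof (ex_series_Cmod_inv_Rcpow_odd s hs) as Ha.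
  assert (HA : forall t, is_series (V := C_R_NormedModule)
    (fun n => / Rcpow (INR (2 * n + 1)) s * RtoC (e n t))%C (A t)).
  { intros t.
    destruct (ex_series_bounded_coeff _ (fun n => e n t) Ha (fun n => He n t)) as [l Hl].
    replace (A t) with l; [exact Hl|]. symmetry; apply CSeries_unique.
    apply (is_series_ext (V := C_R_NormedModule) _ _ _ (fun n => Cmult_comm _ _) Hl). }
  destruct (is_RInt_orthogonal_series e _ _ A K 0 delta (delta / 2) He Ho Ha
    (ex_series_Cmod_odd_powers z hz) HA HK) as [I [HI1 HI2]].
  split; [now exists I|].
  (* The series of [HI1] is [delta] times the one defining [legendre_chi]:
     the [2] of the kernel coefficients cancels the half in [delta / 2]. *)
  rewrite (is_RInt_unique (V := C_R_CompleteNormedModule) _ _ _ _ HI2).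
  apply CSeries_unique.
  refine (is_series_ext (V := C_R_NormedModule) _ _ _ _
            (is_series_Cmult_l (1 / RtoC delta) _ _ HI1)).
  intros n. rewrite RtoC_div by lra.
  assert (hd' : RtoC delta <> 0) by (intros H; now apply hd, RtoC_inj).
  change (1 / delta * (delta / 2 * (/ Rcpow (INR (2 * n + 1)) s * (2 * z ^ (2 * n + 1))))
    = z ^ (2 * n + 1) / Rcpow (INR (2 * n + 1)) s)%C.
  field. split; [|exact hd'].
  apply Cmod_gt_0. rewrite Cmod_Rcpow. apply exp_pos.
Qed.

Theorem theorem1 (delta : R) (s z : C)
    (hdelta : delta = 1 \/ delta = 1 / 2)
    (hs : 1 < Re s) (hz : Cmod z < 1) :
  (ex_RInt (V := C_R_NormedModule)
     (fun t : R => (sin_sum s (PI * t)%R * sin_kernel z t)%C) 0 delta /\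
   legendre_chi s z =
     (1 / RtoC delta *
      RInt (V := C_R_CompleteNormedModule)
        (fun t : R => (sin_sum s (PI * t)%R * sin_kernel z t)%C) 0 delta)%C) /\
  (ex_RInt (V := C_R_NormedModule)
     (fun t : R => (cos_sum s (PI * t)%R * cos_kernel z t)%C) 0 delta /\
   legendre_chi s z =
     (1 / RtoC delta *
      RInt (V := C_R_CompleteNormedModule)
        (fun t : R => (cos_sum s (PI * t)%R * cos_kernel z t)%C) 0 delta)%C).
Proof.
  assert (hd : delta <> 0) by (destruct hdelta; lra).
  split.
  - refine (legendre_chi_RInt (fun n t => sin (INR (2 * n + 1) * (PI * t)))
      (sin_kernel z) delta s z hd hs hz _ _ _).
    + intros n t; apply Rabs_le, SIN_bound.
    + intros j k; exact (proj1 (sin_cos_odd_orthogonal delta j k hdelta)).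
    + intros t; exact (is_series_sin_kernel z t hz).
  - refine (legendre_chi_RInt (fun n t => cos (INR (2 * n + 1) * (PI * t)))
      (cos_kernel z) delta s z hd hs hz _ _ _).
    + intros n t; apply Rabs_le, COS_bound.
    + intros j k; exact (proj2 (sin_cos_odd_orthogonal delta j k hdelta)).
    + intros t; exact (is_series_cos_kernel z t hz).
Qed.
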